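(* Let $\mathbf P$ be a discrete polymatroid on the ground set $[4]=\{1,2,3,4\}$ with ground set rank function $\rho$, and suppose that $\rho(\{i\})<\min\{\rho(\{i,3\}),\rho(\{i,4\})\}$ for $i=1,2$. Then $\mathbf P$ satisfies the left-sided strong symmetric exchange property if and only if $\mathbf P$ is a PLP-polymatroid.
   Context: $[n]=\{1,\dots,n\}$; $\boldsymbol\epsilon_1,\dots,\boldsymbol\epsilon_n$ is the canonical basis of $\mathbb Z^n$; $\mathbb Z_+$ is the set of non-negative integers, and $\mathbb Z_+^n$ is ordered componentwise. A discrete polymatroid on $[n]$ is a nonempty finite set $\mathbf P\subseteq\mathbb Z_+^n$ which is closed under passing to componentwise smaller vectors of $\mathbb Z_+^n$ and such that for $\mathbf u,\mathbf v\in\mathbf P$ with $\sum u_i<\sum v_i$ there is $i$ with $u_i<v_i$ and $\mathbf u+\boldsymbol\epsilon_i\in\mathbf P$. Its bases are its maximal elements; $B$ denotes the set of bases. The ground set rank function $\rho:2^{[n]}\to\mathbb Z_+$ is $\rho(A)=\max\{\sum_{i\in A}u_i:\mathbf u\in\mathbf P\}$ for $A\neq\emptyset$, $\rho(\emptyset)=0$. PLP-polymatroid: let $n,d$ be positive integers and $\mathbf a,\mathbf b,\boldsymbol\alpha,\boldsymbol\beta\in\mathbb Z_+^n$ with $\mathbf a\le\mathbf b$, $\boldsymbol\alpha\le\boldsymbol\beta$, $\alpha_1\le\cdots\le\alpha_n=d$, $\beta_1\le\cdots\le\beta_n=d$. A discrete polymatroid on $[n]$ is a PLP-polymatroid of type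 $(\mathbf a,\mathbf b|\boldsymbol\alpha,\boldsymbol\beta)$ if its set of bases consists of all $\mathbf u\in\mathbb Z_+^n$ with $a_i\le u_i\le b_i$ and $\alpha_i\le u_1+\cdots+u_i\le\beta_i$ for $i=1,\dots,n$; it is a PLP-polymatroid if it is one of some type. $\mathbf P$ satisfies the left-sided strong symmetric exchange property if for all $\mathbf u,\mathbf v\in B$ and all $i$ with $u_i>v_i$ and $u_1+\cdots+u_{i-1}<v_1+\cdots+v_{i-1}$ there exists $j\le i-1$ such that $u_j<v_j$ and both $\mathbf u-\boldsymbol\epsilon_i+\boldsymbol\epsilon_j$ and $\mathbf v+\boldsymbol\epsilon_i-\boldsymbol\epsilon_j$ belong to $B$. *)

(* Defs.v *)
From mathcomp Require Import all_boot.
From mathcomp Require Import finmap.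

Set Implicit Arguments.
Unset Strict Implicit.
Unset Printing Implicit Defensive.

(* The ground set [n] = {1, ..., n} is 'I_n = {0, ..., n-1}: the element k of
   [n] is the ordinal of value k - 1, and vectors of Z_+^n are finite functions. *)
Notation vec n := {ffun 'I_n -> nat}.

Definition vle n (u v : vec n) : bool := [forall i, u i <= v i].

Definition modulus n (u : vec n) : nat := \sum_(i < n) u i.

(* u + epsilon_i *)
Definition add_eps n (u : vec n) (i : 'I_n) : vec n :=
  [ffun k => u k + (k == i)].

(* u - epsilon_i + epsilon_j.  The subtraction is truncated, so this is the
   intended vector only when 0 < u i; this holds wherever it is used below. *)
Definition exchange n (u : vec n) (i j : 'I_n) : vec n :=
  [ffun k => u k - (k == i) + (k == j)].

Definition discrete_polymatroid n (P : {fset vec n}) : Prop :=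
  [/\ P != fset0,
      forall u v : vec n, v \in P -> vle u v -> u \in P
    & forall u v : vec n, u \in P -> v \in P -> modulus u < modulus v ->
        exists i : 'I_n, u i < v i /\ add_eps u i \in P].

(* The maximal elements of P for the componentwise order. *)
Definition bases n (P : {fset vec n}) : {fset vec n} :=
  [fset u in P | all (fun v => vle u v ==> (v == u)) P]%fset.

(* The empty maximum is 0 and the empty sum is 0, so ground_rank P set0 = 0. *)
Definition ground_rank n (P : {fset vec n}) (A : {set 'I_n}) : nat :=
  \max_(u <- P) \sum_(i in A) u i.

(* sum_before u i is u_1 + ... + u_(i-1), sum_upto u i is u_1 + ... + u_i. *)
Definition sum_before n (u : vec n) (i : 'I_n) : nat :=
  \sum_(j < n | j < i) u j.

Definition sum_upto n (u : vec n) (i : 'I_n) : nat :=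
  \sum_(j < n | j <= i) u j.

(* The dimension is n.+1, so that it is positive and ord_max is its last index. *)
Definition PLP_data n (d : nat) (a b alpha beta : vec n.+1) : Prop :=
  [/\ 0 < d,
      vle a b /\ vle alpha beta,
      forall i j : 'I_n.+1, i <= j -> alpha i <= alpha j,
      forall i j : 'I_n.+1, i <= j -> beta i <= beta j
    & alpha ord_max = d /\ beta ord_max = d].

Definition PLP_of_type n (P : {fset vec n.+1}) (a b alpha beta : vec n.+1)
    : Prop :=
  discrete_polymatroid P /\
  forall u : vec n.+1,
    u \in bases P <->
    forall i : 'I_n.+1,
      a i <= u i <= b i /\ alpha i <= sum_upto u i <= beta i.

Definition PLP_polymatroid n (P : {fset vec n.+1}) : Prop :=
  exists (d : nat) (a b alpha beta : vec n.+1),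
    PLP_data d a b alpha beta /\ PLP_of_type P a b alpha beta.

Definition left_strong_symmetric_exchange n (P : {fset vec n}) : Prop :=
  forall u v : vec n, u \in bases P -> v \in bases P ->
  forall i : 'I_n, v i < u i -> sum_before u i < sum_before v i ->
  exists j : 'I_n,
    [/\ j < i, u j < v j,
        exchange u i j \in bases P
      & exchange v j i \in bases P].

(* Main.v *)
Require Import Defs.
From mathcomp Require Import all_boot finmap.
From mathcomp Require Import zify.

(* A polymatroid is cut out by its rank function: u lies in P iff u(A) <= rho(A)
   for all A. On [4], the rank inequalities not available to a PLP-polymatroid
   are those of the pairs {s,t} with s in {1,2} and t in {3,4}. The face
   u(s) + u(t) = rho(st) is a product of two segments; when both are
   nondegenerate, the left-sided exchange between coordinates 1 and 2 leads out
   of the polymatroid. So one of them is a point, and the inequality of {s,t}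
   then follows from those of singletons and their complements. Conversely, in
   a PLP-polymatroid one exchanges at the last position j before i where the
   partial sums of u and v cross: between j and i all the partial sums of u are
   strictly smaller than those of v, so no bound is violated. *)

Set Implicit Arguments.
Unset Strict Implicit.
Unset Printing Implicit Defensive.

(** * Vectors: sums over index sets and the componentwise order *)

Section Vectors.
Variable n : nat.
Implicit Types u v w : vec n.

Lemma vleP u v : reflect (forall i, u i <= v i) (vle u v).
Proof. exact: forallP. Qed.

Lemma sum_eqn_pred (Q : pred 'I_n) i : \sum_(k < n | Q k) (k == i : nat) = Q i.
Proof.
rewrite big_mkcond (bigD1 i) //= big1 ?addn0 => [|k /negPf ->]; last first.
  by case: (Q k).
by rewrite eqxx; case: (Q i).
Qed.

Lemma sum_add_eps (Q : pred 'I_n) u i :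
  \sum_(k < n | Q k) add_eps u i k = \sum_(k < n | Q k) u k + Q i.
Proof.
by rewrite -(sum_eqn_pred Q i) -big_split; apply: eq_bigr => k _; rewrite ffunE.
Qed.

Lemma modulus_add_eps u i : modulus (add_eps u i) = (modulus u).+1.
Proof. by rewrite /modulus (sum_add_eps xpredT) addn1. Qed.

(** Adding [Q i] on the left avoids a subtraction; [0 < u i] makes the truncated one inside
    [exchange] exact. *)
Lemma sum_exchange (Q : pred 'I_n) u i j : 0 < u i ->
  \sum_(k < n | Q k) exchange u i j k + Q i = \sum_(k < n | Q k) u k + Q j.
Proof.
move=> ui; rewrite -(sum_eqn_pred Q i) -(sum_eqn_pred Q j) -!big_split.
apply: eq_bigr => k _; rewrite ffunE /=.
by case: (eqVneq k i) => [->|_] /=; rewrite ?subn0 ?addn0 // addnAC subnK.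
Qed.

Lemma modulusE u : modulus u = \sum_(i in [set: 'I_n]) u i.
Proof. by apply: eq_bigl => i; rewrite in_setT. Qed.

Lemma sum_setC u (A : {set 'I_n}) :
  \sum_(i in A) u i + \sum_(i in ~: A) u i = modulus u.
Proof.
rewrite /modulus [RHS](bigID (mem A)) /=; congr (_ + _).
by apply: eq_bigl => i; rewrite inE.
Qed.

Lemma sum_setC1 u (s : 'I_n) : u s + \sum_(i in [set~ s]) u i = modulus u.
Proof. by rewrite -(sum_setC u [set s]) big_set1. Qed.

Lemma sum_set2 u (s t : 'I_n) :
  s != t -> \sum_(i in [set s; t]) u i = u s + u t.
Proof. by move=> ne_st; rewrite big_setU1 ?big_set1 ?inE. Qed.

Lemma vle_modulus_eq u v : vle u v -> modulus v <= modulus u -> u = v.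
Proof.
move=> /vleP le_uv le_vu; apply/ffunP => i; apply/eqP.
have [_ /esym] := leqif_sum (fun k (_ : true) => leqif_eq (le_uv k)).
rewrite -/(modulus u) -/(modulus v) eqn_leq le_vu andbT.
by rewrite leq_sum // => /forallP/(_ i).
Qed.

Lemma modulus_lt_ex u v : modulus u < modulus v -> exists i, u i < v i.
Proof.
move=> lt_uv; apply/existsP; apply: contraLR lt_uv => /existsPn le_vu.
by rewrite -leqNgt leq_sum // => i _; rewrite leqNgt.
Qed.

Lemma vle_cover u v : vle u v -> modulus v = (modulus u).+1 ->
  exists2 k, u k < v k & v = add_eps u k.
Proof.
move=> le_uv eq_m; have [k lt_k] : exists k, u k < v k.
  by apply: modulus_lt_ex; rewrite eq_m.
exists k => //; apply/esym/vle_modulus_eq; last by rewrite modulus_add_eps eq_m.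
apply/vleP => i; rewrite ffunE; move/vleP: le_uv => /(_ i).
by case: (eqVneq i k) => [->|_]; lia.
Qed.

Definition restrict (A : {set 'I_n}) u : vec n :=
  [ffun i => if i \in A then u i else 0].

Lemma restrict_vle A u : vle (restrict A u) u.
Proof. by apply/vleP => i; rewrite ffunE; case: ifP. Qed.

Lemma modulus_restrict A u : modulus (restrict A u) = \sum_(i in A) u i.
Proof. by rewrite [RHS]big_mkcond; apply: eq_bigr => i _; rewrite ffunE. Qed.

End Vectors.

(** * Discrete polymatroids: rank function, bases, description by rank inequalities *)

Section Polymatroid.
Variables (n : nat) (P : {fset vec n}).
Implicit Types (u v w x : vec n) (A : {set 'I_n}).

Lemma sum_le_rank A u : u \in P -> \sum_(i in A) u i <= ground_rank P A.
Proof. by move=> uP; rewrite /ground_rank (big_rem u uP) leq_maxl. Qed.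

Lemma ground_rank_le A m :
  (forall u, u \in P -> \sum_(i in A) u i <= m) -> ground_rank P A <= m.
Proof. by move=> le_m; apply/bigmax_leqP_seq => u uP _; apply: le_m. Qed.

Lemma ground_rankS A A' : A \subset A' -> ground_rank P A <= ground_rank P A'.
Proof.
move=> sAA'; apply: ground_rank_le => u uP.
apply: leq_trans (sum_le_rank A' uP).
rewrite big_mkcond [leqRHS]big_mkcond leq_sum // => i _.
by case: ifP => // /(subsetP sAA') ->.
Qed.

Lemma ground_rank0 : ground_rank P set0 = 0.
Proof.
by apply/eqP; rewrite -leqn0; apply: ground_rank_le => u _; rewrite big_set0.
Qed.

Hypothesis polyP : discrete_polymatroid P.

Lemma polymatroid_down u v : v \in P -> vle u v -> u \in P.
Proof. by case: polyP => _ down _; apply: down. Qed.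

Lemma zero_in_polymatroid : [ffun=> 0] \in P.
Proof.
case: polyP => /fset0Pn[u uP] _ _; apply: polymatroid_down uP _.
by apply/vleP => i; rewrite ffunE.
Qed.

Lemma ground_rank_attained A :
  exists2 u : vec n, u \in P & \sum_(i in A) u i = ground_rank P A.
Proof.
suff [u uP max_u] : exists2 u : vec n, u \in P &
    forall v, v \in P -> \sum_(i in A) v i <= \sum_(i in A) u i.
  exists u => //; apply/eqP; rewrite eqn_leq sum_le_rank //=.
  exact: ground_rank_le.
pose I := [fset u in P]%fset.
have [/= u _ max_u] := @arg_maxnP P (FSetSub zero_in_polymatroid) xpredT
  (fun u : P => \sum_(i in A) val u i) isT.
by exists (val u) => [|v vP]; [apply: valP | apply: (max_u (FSetSub vP))].
Qed.

(** Iterates the exchange axiom. A coordinate is raised only while it is below that of [w], hence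
    the bound by the maximum. *)
Lemma augment u w : u \in P -> w \in P -> modulus u <= modulus w ->
  exists2 x : vec n, x \in P &
    [/\ vle u x, modulus x = modulus w & forall i, x i <= maxn (u i) (w i)].
Proof.
move=> + wP; have [m] := ubnP (modulus w - modulus u).
elim: m u => // m IH u lt_m uP; rewrite leq_eqVlt => /predU1P[eq_m | lt_uw].
  by exists u => //; split=> // [|i]; [apply/vleP | apply: leq_maxl].
case: polyP => _ _ /(_ u w uP wP lt_uw) [k [lt_k uP']].
have [||x xP [le_x eq_x max_x]] := IH _ _ uP'; rewrite ?modulus_add_eps //.
  lia.
exists x => //; split=> // [|i].
  apply/vleP => i; apply: leq_trans (elimT (vleP _ _) le_x i).
  by rewrite ffunE leq_addr.
have := max_x i; rewrite ffunE; case: (eqVneq i k) => [->|_]; lia.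
Qed.

(** A maximal vector of smaller modulus could be augmented towards a vector of largest modulus. *)
Lemma in_basesP u :
  reflect (u \in P /\ modulus u = ground_rank P setT) (u \in bases P).
Proof.
rewrite !inE /=; apply: (iffP andP) => [[uP /allP max_u]|[uP eq_u]].
  split=> //; have [w wP] := ground_rank_attained setT.
  rewrite -modulusE => eq_w; rewrite -eq_w.
  have le_uw : modulus u <= modulus w by rewrite eq_w modulusE sum_le_rank.
  have [x xP [le_ux <- _]] := augment uP wP le_uw.
  by have /implyP/(_ le_ux)/eqP -> := max_u x xP.
split=> //; apply/allP => v vP; apply/implyP => le_uv; apply/eqP/esym.
by apply: vle_modulus_eq => //; rewrite eq_u modulusE sum_le_rank.
Qed.

(** Augment [u] towards the part on [A'] of a vector attaining the rank of [A']. The coordinates in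
    [A] cannot grow, because [u] is already tight on [A]. *)
Lemma extend_tight A A' u : A \subset A' -> u \in P ->
    (forall i, i \notin A -> u i = 0) -> \sum_(i in A) u i = ground_rank P A ->
  exists2 v : vec n, v \in P &
    [/\ {in A, v =1 u}, forall i, i \notin A' -> v i = 0
      & \sum_(i in A') v i = ground_rank P A'].
Proof.
move=> sAA' uP u0 tight_u; have [w wP tight_w] := ground_rank_attained A'.
have restrict_supp (B : {set 'I_n}) x : (forall i, i \notin B -> x i = 0) ->
    restrict B x = x.
  by move=> x0; apply/ffunP => i; rewrite ffunE; case: ifPn => // /x0.
have uE := restrict_supp _ _ u0.
have wP' : restrict A' w \in P by apply: polymatroid_down wP (restrict_vle _ _).
have [|v vP [le_uv eq_v max_v]] := augment uP wP'.
  by rewrite modulus_restrict tight_w -uE modulus_restrict tight_u ground_rankS.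
have v0 i : i \notin A' -> v i = 0.
  move=> A'i; have := max_v i; rewrite ffunE (negPf A'i) u0; first by lia.
  by apply: contra A'i; apply: (subsetP sAA').
exists v => //; split=> //.
  move=> i Ai.
  have le_u : vle u (restrict A v).
    apply/vleP => k; rewrite ffunE; case: ifPn => [_|/u0 -> //].
    exact: (elimT (vleP _ _) le_uv).
  have -> : u = restrict A v; last by rewrite ffunE Ai.
  apply: vle_modulus_eq => //.
  by rewrite -uE !modulus_restrict tight_u sum_le_rank.
by rewrite -modulus_restrict restrict_supp // eq_v modulus_restrict.
Qed.

(** Greedy construction: start from the zero vector, tight on the empty set, and extend along the
    chain up to the whole ground set. *)
Lemma chain_tight_base A1 A2 A3 : A1 \subset A2 -> A2 \subset A3 ->
  exists2 u : vec n, u \in bases P &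
    [/\ \sum_(i in A1) u i = ground_rank P A1,
        \sum_(i in A2) u i = ground_rank P A2
      & \sum_(i in A3) u i = ground_rank P A3].
Proof.
move=> s12 s23.
have [i _||u1 u1P [_ z1 t1]] := extend_tight (sub0set A1) zero_in_polymatroid.
- by rewrite ffunE.
- by rewrite big_set0 ground_rank0.
have [u2 u2P [e2 z2 t2]] := extend_tight s12 u1P z1 t1.
have [u3 u3P [e3 z3 t3]] := extend_tight s23 u2P z2 t2.
have [u4 u4P [e4 _ t4]] := extend_tight (subsetT A3) u3P z3 t3.
exists u4; first by apply/in_basesP; rewrite modulusE.
split.
- rewrite -t1; apply: eq_bigr => i A1i.
  have A2i := subsetP s12 i A1i.
  by rewrite e4 ?e3 ?e2 // (subsetP s23).
- by rewrite -t2; apply: eq_bigr => i A2i; rewrite e4 ?e3 // (subsetP s23).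
- by rewrite -t3; apply: eq_bigr => i A3i; rewrite e4.
Qed.

(** If [A] were not tight, the part of [u] on [A] could be raised at some [i] in [A]. Augmenting the
    result [y] back to the modulus of [u], while staying below [add_eps u i], shows that direction
    [i] was not blocked. *)
Lemma blocked_directions_tight u : u \in P ->
  let A := [set i | add_eps u i \notin P] in
  \sum_(i in A) u i = ground_rank P A.
Proof.
move=> uP A; apply/eqP; rewrite eqn_leq sum_le_rank //= leqNgt; apply/negP.
have [z zP <-] := ground_rank_attained A; rewrite -!modulus_restrict => lt_uz.
have restrP v : v \in P -> restrict A v \in P.
  by move=> vP; apply: polymatroid_down vP (restrict_vle _ _).
case: polyP => _ _ /(_ _ _ (restrP u uP) (restrP z zP) lt_uz) [i []].
rewrite !ffunE; case: ifPn => // Ai _ yP; set y := add_eps _ _ in yP.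
have uiP : add_eps u i \notin P by rewrite inE in Ai.
have le_y : vle y (add_eps u i).
  by apply/vleP => k; rewrite !ffunE; case: ifP; lia.
have [le_yu|lt_uy] := leqP (modulus y) (modulus u); last first.
  by case/negP: uiP; rewrite -(vle_modulus_eq le_y) // modulus_add_eps.
have [x xP [le_yx eq_x max_x]] := augment yP uP le_yu.
have le_x : vle x (add_eps u i).
  apply/vleP => k; apply: leq_trans (max_x k) _.
  by rewrite geq_max (elimT (vleP _ _) le_y) ffunE leq_addr.
(* [x = u + eps_i - eps_k] for some [k] outside [A]; augmenting [x] towards
   [u + eps_k] can only yield [u + eps_i]. *)
have [|k lt_k def_k] := vle_cover le_x; first by rewrite modulus_add_eps eq_x.
have ukP : add_eps u k \in P.
  apply: contraLR lt_k => ukP; rewrite -leqNgt.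
  have Ak : k \in A by rewrite inE.
  by have := elimT (vleP _ _) le_yx k; rewrite /y !ffunE Ak.
case: polyP => _ _ /(_ _ _ xP ukP); rewrite modulus_add_eps eq_x.
case=> // l [lt_l xlP]; have [def_l|ne_lk] := eqVneq l k.
  by case/negP: uiP; rewrite def_k -def_l.
have := congr1 (fun v : vec n => v l) def_k.
move: lt_l; rewrite !ffunE (negPf ne_lk) !addn0 => + def_l.
by rewrite -def_l ltnNge leq_addr.
Qed.

(** Grow a vector of [P] from zero below [w] until it stops at some [u]. The set [A] of blocked
    directions is tight for [u], so [w] has no larger sum on [A]; off [A], [w] does not exceed [u],
    or growth would continue. Hence [w = u]. *)
Lemma in_polymatroid_of_rank w :
  (forall A, \sum_(i in A) w i <= ground_rank P A) -> w \in P.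
Proof.
move=> le_w; pose z : vec n := [ffun=> 0].
have le_zw : vle z w by apply/vleP => i; rewrite ffunE.
have zP : z \in P := zero_in_polymatroid.
have [m] := ubnP (modulus w - modulus z).
elim: m {zP le_zw}z zP le_zw => // m IH u uP le_uw lt_m.
have [/existsP[i /andP[lt_i uiP]]|/existsPn blocked] :=
  boolP [exists i, (u i < w i) && (add_eps u i \in P)].
  have le_uiw : vle (add_eps u i) w.
    apply/vleP => k; have := elimT (vleP _ _) le_uw k.
    by rewrite ffunE; case: (eqVneq k i) => [->|_]; lia.
  apply: (IH _ uiP le_uiw); rewrite modulus_add_eps.
  have : modulus (add_eps u i) <= modulus w.
    by apply: leq_sum => k _; apply: (elimT (vleP _ _) le_uiw).
  rewrite modulus_add_eps; lia.
suff -> : w = u by [].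
set A := [set i | add_eps u i \notin P].
have offA i : i \notin A -> w i <= u i.
  by rewrite inE negbK => uiP; have := blocked i; rewrite uiP andbT -leqNgt.
apply/esym/vle_modulus_eq => //.
rewrite /modulus (bigID (mem A)) [leqRHS](bigID (mem A)) /=.
apply: leq_add; last exact: leq_sum.
by rewrite (blocked_directions_tight uP) le_w.
Qed.

End Polymatroid.

(** * Left-sided exchange in PLP-polymatroids *)

Lemma last_crossing (U V : nat -> nat) i : U 0 = V 0 -> U i < V i ->
  exists2 j, j < i & V j <= U j /\ forall k, j < k <= i -> U k < V k.
Proof.
move=> eq0; elim: i => [|i IH] lt_i; first by rewrite eq0 ltnn in lt_i.
have [/IH[j lt_ji [le_j lt_k]]|le_i] := ltnP (U i) (V i).
  exists j; first exact: ltnW.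
  split=> // k /andP[lt_jk]; rewrite leq_eqVlt => /predU1P[-> //|lt_ki].
  by apply: lt_k; rewrite lt_jk.
by exists i => //; split=> // k k_i; have -> : k = i.+1 by lia.
Qed.

Section PLP.
Variables (n : nat) (P : {fset vec n.+1}).
Implicit Types u v : vec n.+1.

(** Indexed by naturals so that [last_crossing] applies. Up to conversion, [sum_before u i] is
    [prefix u i] and [sum_upto u i] is [prefix u i.+1]. *)
Let prefix u m := \sum_(k < n.+1 | k < m) u k.

Lemma prefix_sumS u (i : 'I_n.+1) : prefix u i.+1 = prefix u i + u i.
Proof.
rewrite /prefix (bigD1 i) ?ltnS //= addnC; congr (_ + _).
by apply: eq_bigl => k; rewrite ltnS [RHS]ltn_neqAle andbC.
Qed.

Lemma sum_upto_exchange u (i j k : 'I_n.+1) : 0 < u i ->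
  sum_upto (exchange u i j) k + (i <= k) = sum_upto u k + (j <= k).
Proof. exact: sum_exchange. Qed.

Lemma PLP_left_exchange : PLP_polymatroid P -> left_strong_symmetric_exchange P.
Proof.
move=> [d [a [b [alpha [beta [_ [_ basesE]]]]]]] u v uB vB i lt_i lt_before.
have eq0 : prefix u 0 = prefix v 0 by rewrite /prefix !big_pred0.
have [j lt_ji [le_j lt_k]] := last_crossing eq0 lt_before.
have lt_jn : j < n.+1 by apply: ltn_trans lt_ji _.
pose j' := Ordinal lt_jn; exists j'.
have lt_j : u j' < v j'.
  by have := lt_k j.+1; rewrite (prefix_sumS u j') (prefix_sumS v j') /=; lia.
have u_i : 0 < u i by apply: leq_ltn_trans lt_i.
have v_j : 0 < v j' by apply: leq_ltn_trans lt_j.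
have ne_ij : i != j' by rewrite -val_eqE /= neq_ltn lt_ji orbT.
(* Only the partial sums at these [k] change: those of [u] rise by one and those of [v] drop by one,
   so the strict gap keeps both within the bounds. *)
have lt_upto (k : 'I_n.+1) : j <= k < i -> sum_upto u k < sum_upto v k.
  exact: lt_k k.+1.
have uP := (basesE u).1 uB; have vP := (basesE v).1 vB.
split=> //; apply/basesE => k; have [uk su] := uP k; have [vk sv] := vP k.
- split.
    rewrite ffunE; case: (eqVneq k i) => [e|_].
      by subst k; rewrite (negPf ne_ij); lia.
    by case: (eqVneq k j') => [e|_]; [subst k|]; lia.
  by have := lt_upto k; have := sum_upto_exchange j' k u_i; rewrite /=; lia.
- split.
    rewrite ffunE; case: (eqVneq k j') => [e|_].
      by subst k; rewrite eq_sym (negPf ne_ij); lia.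
    by case: (eqVneq k i) => [e|_]; [subst k|]; lia.
  by have := lt_upto k; have := sum_upto_exchange i k v_j; rewrite /=; lia.
Qed.

(** * The tightest PLP type containing the bases *)

Let rho := ground_rank P.
Let d := rho setT.
(** All bases have modulus [d], so [d - rho (~: A)] is the least sum over [A] of a base, just as
    [rho A] is the largest. The subtraction is exact, since [rho] is monotone. *)
Definition tight_lower : vec n.+1 :=
  [ffun i : 'I_n.+1 => d - rho [set~ i]].
Definition tight_upper : vec n.+1 :=
  [ffun i : 'I_n.+1 => rho [set i]].
Definition tight_lower_sums : vec n.+1 :=
  [ffun i : 'I_n.+1 => d - rho (~: [set j : 'I_n.+1 | j <= i])].
Definition tight_upper_sums : vec n.+1 :=
  [ffun i : 'I_n.+1 => rho [set j : 'I_n.+1 | j <= i]].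

Hypothesis polyP : discrete_polymatroid P.

Lemma sum_uptoE u (i : 'I_n.+1) :
  sum_upto u i = \sum_(j in [set j : 'I_n.+1 | j <= i]) u j.
Proof. by apply: eq_bigl => j; rewrite inE. Qed.

Lemma base_sum_bounds u (A : {set 'I_n.+1}) : u \in bases P ->
  d - rho (~: A) <= \sum_(i in A) u i <= rho A.
Proof.
move=> /(in_basesP polyP)[uP]; rewrite -(sum_setC u A) /d /rho => eq_d.
have := sum_le_rank A uP; have := sum_le_rank (~: A) uP; lia.
Qed.

Lemma base_in_tight_box u : u \in bases P -> forall i,
  tight_lower i <= u i <= tight_upper i /\
  tight_lower_sums i <= sum_upto u i <= tight_upper_sums i.
Proof.
move=> uB i; rewrite !ffunE sum_uptoE; split; last exact: base_sum_bounds.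
by have := base_sum_bounds [set i] uB; rewrite big_set1.
Qed.

Lemma tight_PLP_data : 0 < d ->
  PLP_data d tight_lower tight_upper tight_lower_sums tight_upper_sums.
Proof.
move=> d0.
(* Any base separates the lower bounds from the upper ones. *)
have [u uB _] := chain_tight_base polyP (sub0set set0) (sub0set set0).
have prefixS (i j : 'I_n.+1) : i <= j ->
    [set k : 'I_n.+1 | k <= i] \subset [set k : 'I_n.+1 | k <= j].
  by move=> le_ij; apply/subsetP => k; rewrite !inE => /leq_trans; apply.
have prefixT : [set k : 'I_n.+1 | k <= @ord_max n] = setT.
  by apply/setP => k; rewrite !inE leq_ord.
split=> //.
- split; apply/vleP => i; have [u_i sum_i] := base_in_tight_box uB i.
    by case/andP: u_i => /leq_trans le_ui /le_ui.
  by case/andP: sum_i => /leq_trans le_si /le_si.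
- move=> i j /prefixS sij; rewrite !ffunE leq_sub2l // ground_rankS //.
  by rewrite setCS.
- by move=> i j /prefixS sij; rewrite !ffunE ground_rankS.
- by rewrite !ffunE prefixT setCT /d /rho ground_rank0 subn0.
Qed.

End PLP.

(** * Four elements: from left-sided exchange to a PLP type *)

Section GroundSet4.
Variable P : {fset vec 4}.
Hypothesis polyP : discrete_polymatroid P.
Let rho := ground_rank P.
Implicit Types u v w : vec 4.

Lemma modulus4 u (s s' t t' : 'I_4) : uniq [:: s; s'; t; t'] ->
  modulus u = u s + u s' + u t + u t'.
Proof.
move=> uniq_r.
have eqT : [set:: [:: s; s'; t; t']] = setT.
  by apply/eqP; rewrite eqEcard subsetT cardsT card_ord cardsE
    (card_uniqP uniq_r).
rewrite modulusE -eqT; transitivity (\sum_(i <- [:: s; s'; t; t']) u i).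
  by rewrite big_uniq //; apply: eq_bigl => i; rewrite inE.
by rewrite !big_cons big_nil; lia.
Qed.

(* If both inequalities failed, the face [x_s + x_t = rho {s,t}] would be a
   nondegenerate rectangle, on which [x_s] and [x_s'] vary independently;
   exchanging between two of its vertices would leave it through [x_s + x_t]. *)
Lemma degenerate_pair_face (s s' t t' : 'I_4) : uniq [:: s; s'; t; t'] ->
    (forall u v, u \in bases P -> v \in bases P -> u s < v s -> v s' < u s' ->
       exchange u s' s \in bases P) ->
  rho [set s] + rho [set t] <= rho [set s; t] \/
  rho [set~ s'] + rho [set~ t'] <= rho [set s; t] + rho setT.
Proof.
move=> uniq_r exch.
have [|lt_st] :=
  leqP (rho [set s] + rho [set t]) (rho [set s; t]); first by left.
have [|lt_st'] :=
  leqP (rho [set~ s'] + rho [set~ t']) (rho [set s; t] + rho setT);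
  first by right.
have [ne_st ne_s's ne_s't ne_t's ne_t't] :
    [/\ s != t, s' != s, s' != t, t' != s & t' != t].
  move: uniq_r; rewrite /= !inE !negb_or andbT.
  by case/and3P=> /and3P[? ? ?] /andP[? ?] ?; split; rewrite // eq_sym.
have stC x : x != s -> x != t -> [set s; t] \subset [set~ x].
  by move=> xs xt; rewrite subsetC sub1set !inE negb_or xs.
(* Two opposite vertices of the rectangle: [u] has the largest [t] and [s'] coordinates on the face,
   [v] the largest [s] and [t'] coordinates. The two failed inequalities say exactly that
   [u s < v s] and [v s' < u s']. *)
have [u uB [ut ust us']] :=
  chain_tight_base polyP (subsetUr [set s] [set t]) (stC t' ne_t's ne_t't).
have [v vB [vs vst vt']] :=
  chain_tight_base polyP (subsetUl [set s] [set t]) (stC s' ne_s's ne_s't).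
move: ut ust us' vs vst vt'; rewrite !big_set1 !sum_set2 // -/rho.
have [_ um] := in_basesP polyP _ uB; have [_ vm] := in_basesP polyP _ vB.
move: (sum_setC1 u t') (sum_setC1 v s') um vm; rewrite -/rho.
rewrite !(modulus4 _ uniq_r) => hu hv um vm ut ust us' vs vst vt'.
rewrite us' in hu; rewrite vt' in hv.
have lt_s : u s < v s by lia.
have lt_s' : v s' < u s' by lia.
have /(in_basesP polyP)[yP _] := exch u v uB vB lt_s lt_s'.
have := sum_le_rank [set s; t] yP; rewrite sum_set2 // !ffunE eqxx -/rho.
rewrite ![_ == s']eq_sym [t == s]eq_sym.
by rewrite (negPf ne_st) (negPf ne_s's) (negPf ne_s't); lia.
Qed.

(** For the second index the sum before it is the first coordinate alone, and the exchange partner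
    [j] is forced. *)
Lemma left_exchange_first_two (s s' : 'I_4) u v :
    left_strong_symmetric_exchange P -> s < 2 -> s' < 2 -> s != s' ->
    u \in bases P -> v \in bases P -> u s < v s -> v s' < u s' ->
  exchange u s' s \in bases P.
Proof.
move=> lsse; have sum_before1 w (i j : 'I_4) : i = 0 :> nat -> j = 1 :> nat ->
    sum_before w j = w i.
  move=> i0 j1; rewrite /sum_before (big_pred1 i) // => k.
  by rewrite /= -val_eqE /= i0 j1 ltnS leqn0.
move=> s2 s'2 ne_ss' uB vB lt_s lt_s'.
have [s0|s1] : s = 0 :> nat \/ s = 1 :> nat by lia.
  have s'1 : s' = 1 :> nat by move: ne_ss'; rewrite -val_eqE /=; lia.
  have [|j [lt_j _ exch _]] := lsse u v uB vB s' lt_s'.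
    by rewrite !(sum_before1 _ s s').
  by have -> : s = j by apply: val_inj => /=; lia.
have s'0 : s' = 0 :> nat by move: ne_ss'; rewrite -val_eqE /=; lia.
(* Here [s] comes after [s'], so the roles of [u] and [v] are swapped and the second vector of the
   exchange is the one wanted. *)
have [|j [lt_j _ _ exch]] := lsse v u vB uB s lt_s.
  by rewrite !(sum_before1 _ s' s).
by have -> : s' = j by apply: val_inj => /=; lia.
Qed.

(** A vector within the tight bounds satisfies every rank inequality, by the size of [A]: coordinate
    bounds serve for one or three elements, partial sums for the first two or last two indices, and
    [degenerate_pair_face] for mixed pairs. *)
Lemma left_exchange_PLP : 0 < rho setT ->
  left_strong_symmetric_exchange P -> PLP_polymatroid P.
Proof.
move=> d0 lsse; exists (rho setT), (tight_lower P), (tight_upper P),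
  (tight_lower_sums P), (tight_upper_sums P).
split; first exact: tight_PLP_data.
split=> // w; split; first exact: base_in_tight_box.
move=> box.
have bounds (i : 'I_4) : rho setT <= w i + rho [set~ i] /\ w i <= rho [set i].
  by have [] := box i; rewrite !ffunE -/rho; lia.
have bounds_upto (i : 'I_4) (A := [set j : 'I_4 | j <= i]) :
    rho setT <= \sum_(j in A) w j + rho (~: A) /\ \sum_(j in A) w j <= rho A.
  by have [] := box i; rewrite !ffunE sum_uptoE -/rho -/A; lia.
have wd : modulus w = rho setT.
  have [_] := box ord_max; have [_ _ _ _ [-> ->]] := tight_PLP_data polyP d0.
  rewrite -/rho (_ : sum_upto w ord_max = modulus w); first by lia.
  by apply: eq_bigl => j; rewrite leq_ord.
apply/(in_basesP polyP); split=> //; apply: (in_polymatroid_of_rank polyP) => A.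
rewrite -/rho; have : #|A| <= 4 by rewrite -[leqRHS]card_ord max_card.
have := cardsC A; rewrite card_ord.
case cardA : #|A| => [|[|[|[|[|//]]]]] cardC _.
- by rewrite (cards0_eq cardA) big_set0.
- have /cards1P[i ->] : #|A| == 1 by rewrite cardA.
  by rewrite big_set1; case: (bounds i).
- have /cards2P[x [y [ne_xy ->]]] : #|A| == 2 by rewrite cardA.
  wlog lt_xy : x y ne_xy / x < y => [wlog_xy|].
    have [|lt_yx|/val_inj eq_xy] := ltngtP x y; first exact: wlog_xy.
      by rewrite setUC; apply: wlog_xy => //; rewrite eq_sym.
    by rewrite eq_xy eqxx in ne_xy.
  have lt_y4 := ltn_ord y.
  have [y1|y2] := leqP y 1.
    have -> : [set x; y] = [set j : 'I_4 | j <= y].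
      by apply/setP => j; rewrite !inE -!val_eqE /=; lia.
    by case: (bounds_upto y).
  have [x2|x1] := leqP 2 x.
    (* The set is the pair of the last two indices. As [w] has modulus [d], the lower bound on its
       first two coordinates bounds the last two from above. *)
    have [] := bounds_upto (inord 1).
    have -> : [set j : 'I_4 | j <= (inord 1 : 'I_4)] = ~: [set x; y].
      apply/setP => j; have := ltn_ord j.
      by rewrite !inE -!val_eqE /= inordK //; lia.
    by rewrite setCK -wd -(sum_setC w [set x; y]) addnC leq_add2l.
  (* The partners of [x] in [{0, 1}] and of [y] in [{2, 3}]. *)
  pose x' : 'I_4 := inord (1 - x); pose y' : 'I_4 := inord (5 - y).
  have x'E : x' = 1 - x :> nat by rewrite inordK //; lia.
  have y'E : y' = 5 - y :> nat by rewrite inordK //; lia.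
  clearbody x' y'; have uniq_r : uniq [:: x; x'; y; y'].
    by rewrite /= !inE -!val_eqE /= x'E y'E; lia.
  have exch u v : u \in bases P -> v \in bases P -> u x < v x -> v x' < u x' ->
      exchange u x' x \in bases P.
    by apply: left_exchange_first_two => //; rewrite -?val_eqE /= x'E; lia.
  rewrite sum_set2 //; move: wd; rewrite (modulus4 w uniq_r) => wd.
  have [lx ux] := bounds x; have [ly uy] := bounds y.
  have [lx' ux'] := bounds x'; have [ly' uy'] := bounds y'.
  have [|le_st] := degenerate_pair_face uniq_r exch.
    exact: leq_trans (leq_add ux uy).
  (* Add the lower bounds on [w x'] and [w y'], and use that [w x' + w y'] is [d] minus
     [w x + w y]. *)
  rewrite -(leq_add2r (rho setT)); apply: leq_trans le_st.
  by move: lx' ly'; rewrite -wd -/rho; lia.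
- have /cards1P[i Ci] : #|~: A| == 1 by apply/eqP; lia.
  have -> : A = [set~ i] by rewrite -Ci setCK.
  by rewrite -(leq_add2l (w i)) sum_setC1 wd; case: (bounds i).
- have -> : A = setT.
    by apply/eqP; rewrite eqEcard subsetT cardsT card_ord cardA.
  by rewrite -modulusE wd.
Qed.

End GroundSet4.

Theorem proposition2p7 (P : {fset vec 4}) :
  discrete_polymatroid P ->
  (forall i : 'I_4, i < 2 ->
     ground_rank P [set i]%SET <
       minn (ground_rank P [set i; inord 2]%SET)
            (ground_rank P [set i; inord 3]%SET)) ->
  left_strong_symmetric_exchange P <-> PLP_polymatroid P.
Proof.
move=> polyP lt_rank; split; last exact: PLP_left_exchange.
apply: left_exchange_PLP => //.
(* The rank hypothesis at the first index makes [d] positive: the rank of the pair exceeds that of a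
   singleton. *)
apply: leq_trans (ground_rankS P (subsetT [set ord0; inord 2])).
have := lt_rank ord0 isT; rewrite leq_min => /andP[lt_r _].
exact: leq_ltn_trans lt_r.
Qed.
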